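(* Let $R$ be a commutative ring, let $\underline{x} = x_1,\ldots,x_k$ be an ordered sequence of elements of $R$, and let $M$ be an $R$-module. For $0 \le i \le k$ write $\underline{x}_{i} = x_1,\ldots,x_i$ (the empty sequence for $i=0$). The following conditions are equivalent. (i) The sequence $\underline{x}$ is $M$-proregular. (ii) $\check{H}^1_{x_i}\bigl(\Gamma_{\underline{x}_{i-1}}(\operatorname{Hom}_R(M,I))\bigr) = 0$ for all $i = 1,\ldots,k$ and any injective $R$-module $I$.
   Context: Proregular: $\underline{x}=x_1,\ldots,x_k$ is called $M$-proregular if for every $i=1,\ldots,k$ and every positive integer $n$ there is an integer $m\ge n$ such that the map $$(x_1^m,\ldots,x_{i-1}^m)M :_M x_i^m/(x_1^m,\ldots,x_{i-1}^m)M \xrightarrow{\ x_i^{m-n}\ } (x_1^n,\ldots,x_{i-1}^n)M :_M x_i^n/(x_1^n,\ldots,x_{i-1}^n)M$$ induced by multiplication by $x_i^{m-n}$ is zero; equivalently $(x_1^m,\ldots,x_{i-1}^m)M :_M x_i^m \subseteq (x_1^n,\ldots,x_{i-1}^n)M :_M x_i^{m-n}$. Here $N:_M y = \{u\in M : yu\in N\}$; for $i=1$ the submodule $(x_1^m,\ldots,x_{i-1}^m)M$ is $0$. Torsion functor: for an ideal $\mathfrak{a}\subset R$ and an $R$-module $X$, $\Gamma_{\mathfrak{a}}(X)=\{u\in X : \mathfrak{a}^n u=0 \text{ for some } n\ge 1\}$; $\Gamma_{\underline{x}_i}$ means $\Gamma_{\mathfrak{a}}$ with $\mathfrak{a}=(x_1,\ldots,x_i)R$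 (so $\Gamma_{\underline{x}_0}(X)=X$). Čech cohomology: for $y\in R$ and an $R$-module $X$, $\check{H}^1_y(X)$ is the first cohomology of the Čech complex $0\to X\to X_y\to 0$ (with $X$ in degree $0$), i.e. the cokernel of the localization map $X\to X_y$. *)

(* Defs.v *)
Set Warnings "-notation-overridden,-ambiguous-paths,-redundant-canonical-projection".
From HB Require Import structures.
From mathcomp Require Import all_boot all_algebra.
From mathcomp Require Import generic_quotient ring_quotient.
From mathcomp Require Import boolp zify.

Set Implicit Arguments.
Unset Strict Implicit.
Unset Printing Implicit Defensive.

Import GRing.Theory.
Import Quotient.
Local Open Scope ring_scope.
Local Open Scope quotient_scope.

(* A submodule of V is a term of type [submodClosed V]; an ideal of R is a
   submodule of [R^o]. *)

Section Submodules.
Context {R : comPzRingType}.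

Definition wholemod (V : lmodType R) : {pred V} := fun=> true.
Arguments wholemod : clear implicits.

Section Whole.
Context (V : lmodType R).
Fact wholemod_closed : submod_closed (wholemod V).
Proof. by split. Qed.
HB.instance Definition _ :=
  GRing.isSubmodClosed.Build R V (wholemod V) wholemod_closed.
End Whole.

Definition genideal (s : seq R) : {pred R^o} :=
  fun a => `[< exists c : 'I_(size s) -> R, a = \sum_(j < size s) c j * s`_j >].

Section GenIdeal.
Context (s : seq R).
Fact genideal_closed : submod_closed (genideal s).
Proof.
split=> [|a u v /asboolP[c ->] /asboolP[d ->]]; apply/asboolP.
  by exists (fun=> 0); rewrite big1 // => j _; rewrite mul0r.
exists (fun j => a * c j + d j); rewrite scaler_sumr -big_split /=.
by apply: eq_bigr => j _; rewrite mulrDl -mulrA.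
Qed.
HB.instance Definition _ :=
  GRing.isSubmodClosed.Build R R^o (genideal s) genideal_closed.
End GenIdeal.

(* The submodule I N, consisting of the finite sums of products a *: u with
   a in I and u in N. *)
Definition ideal_mul (V : lmodType R) (I : submodClosed R^o)
    (N : submodClosed V) : {pred V} :=
  fun v => `[< exists2 s : seq (R^o * V),
                 all (fun p => (p.1 \in I) && (p.2 \in N)) s
               & v = \sum_(p <- s) (p.1 : R) *: p.2 >].

Section IdealMul.
Context (V : lmodType R) (I : submodClosed R^o) (N : submodClosed V).
Fact ideal_mul_closed : submod_closed (ideal_mul I N).
Proof.
split=> [|a u v /asboolP[s sP ->] /asboolP[t tP ->]]; apply/asboolP.
  by exists [::]; rewrite // big_nil.
exists ([seq (p.1, a *: p.2) | p <- s] ++ t).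
  rewrite all_cat tP andbT all_map; apply: sub_all sP => p /= /andP[-> pN].
  exact: rpredZ.
rewrite big_cat big_map scaler_sumr /=; congr (_ + _).
by apply: eq_bigr => p _; rewrite !scalerA mulrC.
Qed.
HB.instance Definition _ :=
  GRing.isSubmodClosed.Build R V (ideal_mul I N) ideal_mul_closed.
End IdealMul.

Fixpoint ideal_exp (I : submodClosed R^o) (n : nat) : submodClosed R^o :=
  if n is n'.+1 then ideal_mul I (ideal_exp I n') else wholemod R^o.

Definition colon (V : lmodType R) (N : submodClosed V) (y : R) : {pred V} :=
  fun u => y *: u \in N.

Section Colon.
Context (V : lmodType R) (N : submodClosed V) (y : R).
Lemma colonE u : (u \in colon N y) = (y *: u \in N).
Proof. by []. Qed.

Fact colon_closed : submod_closed (colon N y).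
Proof.
split=> [|a u v]; rewrite !colonE ?scaler0 ?rpred0 // => yu yv.
by rewrite scalerDr scalerA mulrC -scalerA rpredD // rpredZ.
Qed.
HB.instance Definition _ :=
  GRing.isSubmodClosed.Build R V (colon N y) colon_closed.
End Colon.

Lemma ideal_mul_sub (V : lmodType R) (I : submodClosed R^o)
  (N : submodClosed V) : {subset ideal_mul I N <= N}.
Proof.
move=> v /asboolP[s sP ->]; rewrite big_seq rpred_sum // => p ps.
by have /andP[_ pN] := allP sP p ps; rewrite rpredZ.
Qed.

Lemma ideal_exp_sub (I : submodClosed R^o) m n :
  (n <= m)%N -> {subset ideal_exp I m <= ideal_exp I n}.
Proof.
move=> /subnK <-; elim: (m - n)%N => // k IHk a aI.
exact/IHk/(ideal_mul_sub aI).
Qed.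

Definition torsion (V : lmodType R) (I : submodClosed R^o) : {pred V} :=
  fun u => `[< exists2 n : nat, (1 <= n)%N
                 & forall a : R, a \in ideal_exp I n -> a *: u = 0 >].
Arguments torsion : clear implicits.

Section Torsion.
Context (V : lmodType R) (I : submodClosed R^o).
Fact torsion_closed : submod_closed (torsion V I).
Proof.
split=> [|a u v /asboolP[m m_gt0 mu] /asboolP[n n_gt0 nv]]; apply/asboolP.
  by exists 1%N => // a _; rewrite scaler0.
exists (maxn m n) => [|b bI]; first by rewrite leq_max m_gt0.
rewrite scalerDr scalerA mulrC -scalerA mu ?nv ?scaler0 ?addr0 //.
  by apply: ideal_exp_sub bI; rewrite leq_maxr.
by apply: ideal_exp_sub bI; rewrite leq_maxl.
Qed.
HB.instance Definition _ :=
  GRing.isSubmodClosed.Build R V (torsion V I) torsion_closed.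
End Torsion.

Definition range (U V : lmodType R) (f : {linear U -> V}) : {pred V} :=
  fun v => `[< exists u, f u = v >].

Section Range.
Context (U V : lmodType R) (f : {linear U -> V}).
Fact range_closed : submod_closed (range f).
Proof.
split=> [|a u v /asboolP[u' <-] /asboolP[v' <-]]; apply/asboolP.
  by exists 0; rewrite linear0.
by exists (a *: u' + v'); rewrite linearP.
Qed.
HB.instance Definition _ :=
  GRing.isSubmodClosed.Build R V (range f) range_closed.
End Range.

Section SubmodType.
Context (V : lmodType R) (N : submodClosed V).

Record submod_of : predArgType :=
  Submod { submod_val : V; submod_valP : submod_val \in N }.

HB.instance Definition _ := [isSub for submod_val].
HB.instance Definition _ := [Choice of submod_of by <:].
HB.instance Definition _ := [SubChoice_isSubLmodule of submod_of by <:].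

End SubmodType.

Section Quotient.
Context (V : lmodType R) (N : submodClosed V).

(* [submodClosed] does not record closure under opposites, which {quot _}
   requires; over a ring it follows from closure under scaling. *)
Definition zpred : {pred V} := fun u => u \in N.
HB.instance Definition _ := GRing.isZmodClosed.Build V zpred
  (GRing.submod_closedB (submodClosedP N)).

Definition quot_mod : Type := {quot zpred}.

HB.instance Definition _ := GRing.Zmodule.on quot_mod.

Definition quot_proj (u : V) : quot_mod := \pi_({quot zpred}) u.

Lemma quot_projE u v : (quot_proj u == quot_proj v) = (u - v \in N).
Proof. by rewrite -[RHS]/(u - v \in zpred) idealrBE. Qed.

Lemma quot_proj_surj (q : quot_mod) : exists u, quot_proj u = q.
Proof. by exists (repr (q : {quot zpred})); rewrite /quot_proj reprK. Qed.

Fact quot_projD : {morph quot_proj : u v / u + v}.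
Proof. by move=> u v; rewrite /quot_proj pi_addr. Qed.

Definition quot_scale (a : R) (q : quot_mod) : quot_mod :=
  quot_proj (a *: repr (q : {quot zpred})).

Fact quot_projZ a u : quot_proj (a *: u) = quot_scale a (quot_proj u).
Proof.
apply/eqP; rewrite quot_projE -scalerBr rpredZ //.
by rewrite -[_ \in _]/(_ \in zpred) idealrBE /quot_proj reprK.
Qed.

Fact quot_scaleA a b q : quot_scale a (quot_scale b q) = quot_scale (a * b) q.
Proof. by have [u <-] := quot_proj_surj q; rewrite -!quot_projZ scalerA. Qed.

Fact quot_scale1 : left_id 1 quot_scale.
Proof.
by move=> q; have [u <-] := quot_proj_surj q; rewrite -quot_projZ scale1r.
Qed.

Fact quot_scaleDr : right_distributive quot_scale +%R.
Proof.
move=> a p q; have [u <-] := quot_proj_surj p; have [v <-] := quot_proj_surj q.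
by rewrite -quot_projD -!quot_projZ scalerDr quot_projD.
Qed.

Fact quot_scaleDl q : {morph quot_scale^~ q : a b / a + b}.
Proof.
move=> a b; have [u <-] := quot_proj_surj q.
by rewrite -!quot_projZ scalerDl quot_projD.
Qed.

HB.instance Definition _ := GRing.Zmodule_isLmodule.Build R quot_mod
  quot_scaleA quot_scale1 quot_scaleDr quot_scaleDl.

Fact quot_proj_is_linear : linear quot_proj.
Proof. by move=> a u v; rewrite quot_projD quot_projZ. Qed.

HB.instance Definition _ :=
  GRing.isLinear.Build R V quot_mod *:%R quot_proj quot_proj_is_linear.

Lemma quot_proj_eq0 u : (quot_proj u == 0) = (u \in N).
Proof. by rewrite -(raddf0 quot_proj) quot_projE subr0. Qed.

End Quotient.

Section QuotientMap.
Context (U V : lmodType R) (A : submodClosed U) (B : submodClosed V).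
Context (f : {linear U -> V}).

Definition quot_map (_ : forall u, u \in A -> f u \in B) (q : quot_mod A) :
  quot_mod B := quot_proj B (f (repr (q : {quot (zpred A)}))).

Context (fAB : forall u, u \in A -> f u \in B).

Lemma quot_mapE u : quot_map fAB (quot_proj A u) = quot_proj B (f u).
Proof.
apply/eqP; rewrite quot_projE -raddfB fAB //.
by rewrite -[_ \in _]/(_ \in zpred A) idealrBE /quot_proj reprK.
Qed.

Fact quot_map_is_linear : linear (quot_map fAB).
Proof.
move=> a p q; have [u <-] := quot_proj_surj p; have [v <-] := quot_proj_surj q.
by rewrite -linearP !quot_mapE !linearP.
Qed.

HB.instance Definition _ := GRing.isLinear.Build R (quot_mod A) (quot_mod B)
  *:%R (quot_map fAB) quot_map_is_linear.

End QuotientMap.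

(* [subquot A N] is the module A / N when N is contained in A. *)
Section SubQuotient.
Context (V : lmodType R).
Implicit Types A N : submodClosed V.

Definition restr_sub A N : {pred submod_of A} := fun u => submod_val u \in N.
Arguments restr_sub : clear implicits.

Lemma restr_subE A N (u : submod_of A) : (u \in restr_sub A N) = (submod_val u \in N).
Proof. by []. Qed.

Fact restr_sub_closed A N : submod_closed (restr_sub A N).
Proof.
split=> [|a u v]; rewrite !restr_subE ?rpred0 // => uN vN.
by rewrite rpredD // rpredZ.
Qed.

HB.instance Definition _ A N := GRing.isSubmodClosed.Build R (submod_of A)
  (restr_sub A N) (@restr_sub_closed A N).

Definition subquot A N := quot_mod (restr_sub A N).

End SubQuotient.
Arguments restr_sub {V}.

Section Proregular.
Context (M : lmodType R).
Implicit Types (s : seq R) (y : R) (m n : nat).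

(* (s_1^n, ..., s_r^n) M *)
Definition pow_sub s n : submodClosed M :=
  ideal_mul (genideal [seq z ^+ n | z <- s]) (wholemod M).

Lemma pow_sub_le s m n : (n <= m)%N -> {subset pow_sub s m <= pow_sub s n}.
Proof.
move=> le_nm u /asboolP[t tP ->]; apply/asboolP; exists t => //.
apply: sub_all tP => p; rewrite !andbT => /asboolP pI; apply/asboolP.
move: pI; rewrite !size_map => -[c ->]; exists (fun j => c j * s`_j ^+ (m - n)).
apply: eq_bigr => j _; rewrite (nth_map 0) // (nth_map 0) //.
by rewrite -mulrA -exprD subnK.
Qed.

Definition pow_colon s y n : submodClosed M := colon (pow_sub s n) (y ^+ n).

Section Transition.
Context (s : seq R) (y : R) (m n : nat) (le_nm : (n <= m)%N).

Fact pow_colon_mulP (u : submod_of (pow_colon s y m)) :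
  y ^+ (m - n) *: submod_val u \in pow_colon s y n.
Proof.
rewrite colonE scalerA -exprD subnKC //.
exact: (pow_sub_le le_nm (submod_valP u)).
Qed.

Definition pow_colon_mul (u : submod_of (pow_colon s y m)) :
  submod_of (pow_colon s y n) := Submod (pow_colon_mulP u).

Fact pow_colon_mul_is_linear : linear pow_colon_mul.
Proof.
move=> a u v; apply: val_inj; rewrite /= scalerDr !scalerA.
by rewrite mulrC.
Qed.

HB.instance Definition _ := GRing.isLinear.Build R
  (submod_of (pow_colon s y m)) (submod_of (pow_colon s y n)) *:%R
  pow_colon_mul pow_colon_mul_is_linear.

Fact pow_colon_mul_restr u :
  u \in restr_sub (pow_colon s y m) (pow_sub s m) ->
  pow_colon_mul u \in restr_sub (pow_colon s y n) (pow_sub s n).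
Proof. by rewrite !restr_subE => us; rewrite rpredZ // (pow_sub_le le_nm). Qed.

Definition proreg_map : subquot (pow_colon s y m) (pow_sub s m) ->
    subquot (pow_colon s y n) (pow_sub s n) :=
  quot_map pow_colon_mul_restr.

Lemma proreg_map_eq0 : (forall q, proreg_map q = 0) <->
  (forall u : M, u \in pow_colon s y m ->
                 u \in colon (pow_sub s n) (y ^+ (m - n))).
Proof.
split=> [map0 u uC|sub q].
  have /eqP := map0 (quot_proj _ (Submod uC)).
  by rewrite /proreg_map quot_mapE quot_proj_eq0.
have [u <-] := quot_proj_surj q; apply/eqP.
by rewrite /proreg_map quot_mapE quot_proj_eq0; apply: sub (submod_valP u).
Qed.

End Transition.
Arguments proreg_map s y {m n} le_nm q.

(* [i : 'I_k] stands for the index i + 1 of the sequence x_1, ..., x_k, so that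
   [take i x] consists of the elements strictly before [tnth x i]. *)
Definition proregular (k : nat) (x : k.-tuple R) : Prop :=
  forall (i : 'I_k) (n : nat), (0 < n)%N ->
  exists (m : nat) (le_nm : (n <= m)%N),
  forall q, proreg_map (take i x) (tnth x i) le_nm q = 0.

End Proregular.

Section HomMod.
Context (M I : lmodType R).

Definition hom_mod : Type := {linear M -> I}.

HB.instance Definition _ := gen_eqMixin hom_mod.
HB.instance Definition _ := gen_choiceMixin hom_mod.

Implicit Types f g h : hom_mod.

Lemma hom_modP f g : (f : M -> I) =1 g -> f = g.
Proof.
case: f g => [f [[fD] [fZ]]] [g [[gD] [gZ]]] /= /funext fg.
by case: _ / fg in gD gZ *; congr GRing.Linear.Pack;
  rewrite (Prop_irrelevance fD gD) (Prop_irrelevance fZ gZ).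
Qed.

Definition hom_mod0 : hom_mod := \0 : {linear M -> I}.
Definition hom_mod_opp f : hom_mod := (\- f) : {linear M -> I}.
Definition hom_mod_add f g : hom_mod := (f \+ g) : {linear M -> I}.
Definition hom_mod_scale (a : R) f : hom_mod := (a \*: f) : {linear M -> I}.

Fact hom_mod_addA : associative hom_mod_add.
Proof. by move=> f g h; apply: hom_modP => u /=; rewrite addrA. Qed.

Fact hom_mod_addC : commutative hom_mod_add.
Proof. by move=> f g; apply: hom_modP => u /=; rewrite addrC. Qed.

Fact hom_mod_add0 : left_id hom_mod0 hom_mod_add.
Proof. by move=> f; apply: hom_modP => u /=; rewrite add0r. Qed.

Fact hom_mod_addN : left_inverse hom_mod0 hom_mod_opp hom_mod_add.
Proof. by move=> f; apply: hom_modP => u /=; rewrite addNr. Qed.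

HB.instance Definition _ :=
  GRing.isZmodule.Build hom_mod
    hom_mod_addA hom_mod_addC hom_mod_add0 hom_mod_addN.

Fact hom_mod_scaleA a b f :
  hom_mod_scale a (hom_mod_scale b f) = hom_mod_scale (a * b) f.
Proof. by apply: hom_modP => u /=; rewrite scalerA. Qed.

Fact hom_mod_scale1 : left_id 1 hom_mod_scale.
Proof. by move=> f; apply: hom_modP => u /=; rewrite scale1r. Qed.

Fact hom_mod_scaleDr : right_distributive hom_mod_scale +%R.
Proof. by move=> a f g; apply: hom_modP => u /=; rewrite scalerDr. Qed.

Fact hom_mod_scaleDl f : {morph hom_mod_scale^~ f : a b / a + b}.
Proof. by move=> a b; apply: hom_modP => u /=; rewrite scalerDl. Qed.

HB.instance Definition _ := GRing.Zmodule_isLmodule.Build R hom_mod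
  hom_mod_scaleA hom_mod_scale1 hom_mod_scaleDr hom_mod_scaleDl.

End HomMod.

Definition injective_module (I : lmodType R) : Prop :=
  forall (A B : lmodType R) (f : {linear A -> B}) (g : {linear A -> I}),
    injective f -> exists h : {linear B -> I}, forall a, h (f a) = g a.

(* The localization X_y; the pair (u, n) stands for the fraction u / y^n. *)
Section Localization.
Context (y : R) (X : lmodType R).
Implicit Types p q : X * nat.

Definition loc_rel p q : bool :=
  `[< exists k, y ^+ (k + q.2) *: p.1 = y ^+ (k + p.2) *: q.1 >].

Fact loc_rel_equiv : equiv_class_of loc_rel.
Proof.
split=> [p|p q|q p r].
- by apply/asboolP; exists 0%N.
- by apply/asboolP/asboolP => -[k kE]; exists k.
move=> /asboolP[k kE] /asboolP[l lE]; apply/asboolP.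
exists (k + l + q.2)%N.
transitivity (y ^+ (l + r.2) *: (y ^+ (k + q.2) *: p.1)).
  by rewrite scalerA -exprD; congr (_ ^+ _ *: _); rewrite -!addnA; lia.
rewrite kE scalerA -exprD addnC exprD -scalerA.
transitivity (y ^+ (k + p.2) *: (y ^+ (l + q.2) *: r.1)).
  by rewrite -lE.
by rewrite scalerA -exprD; congr (_ ^+ _ *: _); lia.
Qed.

Canonical loc_equiv := EquivRelPack loc_rel_equiv.
Canonical loc_encModRel := defaultEncModRel loc_rel.

Definition loc : Type := {eq_quot loc_rel}.

HB.instance Definition _ := Choice.on loc.

Definition loc_frac (u : X) (n : nat) : loc := \pi_({eq_quot loc_rel}) (u, n).

Lemma loc_fracP u m v n :
  loc_frac u m = loc_frac v n <->
  exists k, y ^+ (k + n) *: u = y ^+ (k + m) *: v.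
Proof.
split=> [/eqP|kE]; first by rewrite eqmodE => /asboolP.
by apply/eqP; rewrite eqmodE; apply/asboolP.
Qed.

Lemma loc_fracX (l : loc) : exists u n, loc_frac u n = l.
Proof.
exists (repr (l : {eq_quot loc_rel})).1, (repr (l : {eq_quot loc_rel})).2.
by rewrite /loc_frac -surjective_pairing reprK.
Qed.

(* A representative; well-definedness is the content of [loc_oppE], [loc_addE]
   and [loc_scaleE]. *)
Definition loc_rep (l : loc) : X * nat := repr (l : {eq_quot loc_rel}).

Definition loc_opp (l : loc) : loc := loc_frac (- (loc_rep l).1) (loc_rep l).2.

Definition loc_add (l l' : loc) : loc :=
  loc_frac (y ^+ (loc_rep l').2 *: (loc_rep l).1
              + y ^+ (loc_rep l).2 *: (loc_rep l').1)
           ((loc_rep l).2 + (loc_rep l').2).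

Definition loc_scale (a : R) (l : loc) : loc :=
  loc_frac (a *: (loc_rep l).1) (loc_rep l).2.

Lemma loc_repP u n :
  exists k, y ^+ (k + n) *: (loc_rep (loc_frac u n)).1
            = y ^+ (k + (loc_rep (loc_frac u n)).2) *: u.
Proof.
apply/loc_fracP; rewrite /loc_frac -surjective_pairing.
by rewrite /loc_rep reprK.
Qed.

Lemma loc_oppE u n : loc_opp (loc_frac u n) = loc_frac (- u) n.
Proof.
apply/loc_fracP; have [k kE] := loc_repP u n.
by exists k; rewrite !scalerN kE.
Qed.

Lemma loc_scaleE a u n : loc_scale a (loc_frac u n) = loc_frac (a *: u) n.
Proof.
apply/loc_fracP; have [k kE] := loc_repP u n.
by exists k; rewrite !scalerA ![_ * a]mulrC -!scalerA kE.
Qed.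

Lemma loc_addE u m v n : loc_add (loc_frac u m) (loc_frac v n)
  = loc_frac (y ^+ n *: u + y ^+ m *: v) (m + n).
Proof.
apply/loc_fracP; have [k kE] := loc_repP u m; have [l lE] := loc_repP v n.
case: (loc_rep _) kE => u' m' /= kE; case: (loc_rep _) lE => v' n' /= lE.
exists (k + l)%N; rewrite !scalerDr !scalerA -!exprD; congr (_ + _).
  rewrite (_ : (k + l + (m + n) + n' = (l + n + n') + (k + m))%N); last by lia.
  by rewrite exprD -scalerA kE scalerA -exprD; congr (_ ^+ _ *: _); lia.
rewrite (_ : (k + l + (m + n) + m' = (k + m + m') + (l + n))%N); last by lia.
by rewrite exprD -scalerA lE scalerA -exprD; congr (_ ^+ _ *: _); lia.
Qed.

Lemma loc_frac_shift u k n : loc_frac (y ^+ k *: u) (k + n) = loc_frac u n.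
Proof.
apply/loc_fracP; exists 0%N; rewrite !add0n scalerA -exprD.
by rewrite addnC.
Qed.

Fact loc_addA : associative loc_add.
Proof.
move=> l1 l2 l3; have [u [m <-]] := loc_fracX l1.
have [v [n <-]] := loc_fracX l2; have [w [r <-]] := loc_fracX l3.
rewrite !loc_addE addnA !scalerDr !scalerA -!exprD addrA.
by rewrite (addnC r n) (addnC r m).
Qed.

Fact loc_addC : commutative loc_add.
Proof.
move=> l1 l2; have [u [m <-]] := loc_fracX l1; have [v [n <-]] := loc_fracX l2.
by rewrite !loc_addE addrC addnC.
Qed.

Fact loc_add0 : left_id (loc_frac 0 0) loc_add.
Proof.
move=> l; have [u [m <-]] := loc_fracX l.
by rewrite loc_addE scaler0 add0r expr0 scale1r.
Qed.

Fact loc_addN : left_inverse (loc_frac 0 0) loc_opp loc_add.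
Proof.
move=> l; have [u [m <-]] := loc_fracX l.
rewrite loc_oppE loc_addE scalerN addNr.
by apply/loc_fracP; exists 0%N; rewrite !scaler0.
Qed.

HB.instance Definition _ :=
  GRing.isZmodule.Build loc loc_addA loc_addC loc_add0 loc_addN.

Fact loc_scaleA a b l : loc_scale a (loc_scale b l) = loc_scale (a * b) l.
Proof. by have [u [m <-]] := loc_fracX l; rewrite !loc_scaleE scalerA. Qed.

Fact loc_scale1 : left_id 1 loc_scale.
Proof.
by move=> l; have [u [m <-]] := loc_fracX l; rewrite loc_scaleE scale1r.
Qed.

Fact loc_scaleDr : right_distributive loc_scale +%R.
Proof.
move=> a l1 l2; have [u [m <-]] := loc_fracX l1.
have [v [n <-]] := loc_fracX l2.
rewrite -[_ + _]/(loc_add _ _) -[RHS]/(loc_add _ _) !(loc_scaleE, loc_addE).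
by rewrite scalerDr !scalerA ![a * _]mulrC.
Qed.

Fact loc_scaleDl l : {morph loc_scale^~ l : a b / a + b}.
Proof.
move=> a b; have [u [m <-]] := loc_fracX l.
rewrite -[RHS]/(loc_add _ _) !(loc_scaleE, loc_addE).
by rewrite -scalerDr -scalerDl loc_frac_shift.
Qed.

HB.instance Definition _ := GRing.Zmodule_isLmodule.Build R loc
  loc_scaleA loc_scale1 loc_scaleDr loc_scaleDl.

Definition loc_map (u : X) : loc := loc_frac u 0.

Fact loc_map_is_linear : linear loc_map.
Proof.
move=> a u v.
rewrite -[RHS]/(loc_add (loc_scale _ _) _) /loc_map loc_scaleE loc_addE.
by rewrite expr0 !scale1r.
Qed.

HB.instance Definition _ :=
  GRing.isLinear.Build R X loc *:%R loc_map loc_map_is_linear.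

End Localization.
Arguments loc_map : clear implicits.

(* The first cohomology of the complex 0 -> X -> X_y -> 0 *)
Definition cech_H1 (y : R) (X : lmodType R) : lmodType R :=
  quot_mod (range (loc_map y X)).

Definition Gamma (I : submodClosed R^o) (X : lmodType R) : lmodType R :=
  submod_of (torsion X I).

End Submodules.

Arguments wholemod {R}.
Arguments torsion {R}.
Arguments loc_map {R}.
Arguments proreg_map {R M} s y {m n} le_nm q.
Arguments restr_sub {R V}.

(* Main.v *)
Require Import Defs.
From mathcomp Require Import all_boot all_algebra.
From HB Require Import structures.
From mathcomp Require Import generic_quotient ring_quotient.
From mathcomp Require Import boolp classical_sets functions zify.

Set Implicit Arguments.
Unset Strict Implicit.
Unset Printing Implicit Defensive.

Import GRing.Theory Num.Theory Quotient.
Local Open Scope ring_scope.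
Local Open Scope quotient_scope.

(* Write s = x_1, ..., x_(i-1) and y = x_i.  A homomorphism f : M -> I is
   s-torsion iff it kills s^(n) M = (x_1^n, ..., x_(i-1)^n) M for some n, and the
   first Cech cohomology of X vanishes iff every f / y^n in X_y comes from X.

   If s^(m) M : y^m lies in s^(n) M : y^(m-n) and f kills s^(n) M, then
   y^(m-n) f factors through M / (s^(m) M : y^m), which multiplication by y^m
   embeds into M / s^(m) M; an extension g : M / s^(m) M -> I satisfies
   y^m g = y^(m-n) f, so f / y^n = g.

   Conversely let f be the composite of M -> M / s^(n) M with an embedding into
   an injective module.  If f / y^n = g with g killing s^(l) M, then
   y^(m-n) f = y^m g for all large m, and evaluating at u in s^(m) M : y^m gives
   f (y^(m-n) u) = 0, i.e. y^(m-n) u lies in s^(n) M.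

   Enough injectives: a divisible group E is injective by Zorn's lemma, so that
   Hom_Z(R, E) is an injective R-module, and N embeds into Hom_Z(R, (Q/Z)^J)
   where J is the set of characters N -> Q/Z. *)

(** * Extension of additive maps into divisible groups *)

(** The generator is the least positive element, by Euclidean division; [n = 0] accounts for the
    zero subgroup. *)
Lemma int_subgroup_dvdP (P : int -> Prop) : P 0 ->
    (forall a b, P a -> P b -> P (a - b)) ->
  exists n : nat, forall z : int, P z <-> (n%:Z %| z)%Z.
Proof.
move=> P0 PB.
have PN a : P a -> P (- a) by move=> Pa; rewrite -sub0r; apply: PB.
have PD a b : P a -> P b -> P (a + b).
  by move=> Pa Pb; rewrite -[b]opprK; apply/PB/PN.
have PM a z : P a -> P (z * a).
  move=> Pa; have PMn n : P (n%:Z * a).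
    elim: n => [|n IHn]; first by rewrite mul0r.
    by rewrite intS mulrDl mul1r; apply: PD.
  by case: (intP z) => [|n|n]; rewrite ?mul0r ?mulNr //; apply: PN.
have [[n0 n0_gt0 Pn0]|noP] := pselect (exists2 n : nat, (0 < n)%N & P n%:Z).
  pose Q n := (0 < n)%N && `[< P n%:Z >].
  have exQ : exists n, Q n by exists n0; rewrite /Q n0_gt0; apply/asboolP.
  case: (ex_minnP exQ) => n /andP[n_gt0 /asboolP Pn] n_min.
  exists n => z; split=> [Pz|/dvdzP[q ->]]; last exact: PM.
  have Pr : P (z %% n)%Z.
    have -> : (z %% n)%Z = z - (z %/ n)%Z * n.
      by rewrite {2}(divz_eq z n) addrC addKr.
    exact/PB/PM.
  have r_ge0 : (0 <= (z %% n)%Z) by rewrite modz_ge0 //; lia.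
  have r_lt : ((z %% n)%Z < n) by rewrite ltz_pmod.
  apply/dvdz_mod0P; move: Pr r_ge0 r_lt.
  case: (z %% n)%Z => // -[//|r] Pr _ r_lt.
  have /n_min : Q r.+1 by rewrite /Q; apply/asboolP.
  by lia.
exists 0%N => z; split=> [Pz|]; last by rewrite dvd0z => /eqP->.
rewrite dvd0z; apply/eqP; case: z Pz => -[|n] // Pz; case: noP.
  by exists n.+1.
  by exists 1%N => //; apply: PN Pz.
by exists n.+2 => //; apply: PN Pz.
Qed.

Definition divisible (E : zmodType) :=
  forall (e : E) n, (0 < n)%N -> exists d, d *+ n = e.

Section Extension.
Context (B E : zmodType).
Implicit Types (G : set (B * E)) (p q : B * E).

(** Such a nonempty [G] is the graph of an additive map on a subgroup of [B]. The empty set also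
    qualifies, hence the separate hypothesis [G 0] below. *)
Definition partial_hom G :=
  (forall p q, G p -> G q -> G (p - q)) /\ (forall e, G (0, e) -> e = 0).

(** For a subgroup [G], this is the subgroup generated by [G] and [p]. *)
Definition adjoin G p : set (B * E) :=
  fun q => exists z : int, G (q - p *~ z).

Lemma partial_hom0 : partial_hom [set 0].
Proof. by split=> [p q -> ->|e [->]] //; rewrite subr0. Qed.

Lemma pairB (b c : B) (d e : E) : (b, d) - (c, e) = (b - c, d - e).
Proof. by []. Qed.

Lemma pair_mulrz p (z : int) : p *~ z = (p.1 *~ z, p.2 *~ z).
Proof.
rewrite [LHS]surjective_pairing; congr (_, _).
  exact: (raddfMz (@fst B E)).
exact: (raddfMz (@snd B E)).
Qed.

(** If (0, e) = g + z p with g in [G], compatibility at -z forces the second coordinate of g to be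
    -z [p.2], so e = 0. *)
Lemma partial_hom_adjoin G p : partial_hom G ->
    (forall z d, G (p.1 *~ z, d) -> d = p.2 *~ z) ->
  partial_hom (adjoin G p).
Proof.
move=> [GB G0] Gp; split=> [q r [z Gz] [w Gw]|e [z Gz]].
  exists (z - w); rewrite mulrzBr.
  by rewrite opprD addrACA -opprD; apply: GB.
have := Gp (- z) (e - p.2 *~ z); rewrite !mulrNz => /(_ _)/eqP.
rewrite -subr_eq0 opprK addrNK => /(_ _)/eqP; apply.
by move: Gz; rewrite pair_mulrz pairB sub0r.
Qed.

(** The [z] with [b *~ z] in the domain of [G] are the multiples of some [n]. Divisibility yields an
    n-th part [d] of the value at [b *~ n]; for [n = 0] any [d] works and 0 is taken. *)
Lemma partial_hom_step G b : partial_hom G -> G 0 -> divisible E ->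
  exists d, forall z e, G (b *~ z, e) -> e = d *~ z.
Proof.
move=> [GB Gfun] G0 divE.
have [||n nP] := @int_subgroup_dvdP (fun z => exists d, G (b *~ z, d)).
- by exists 0; rewrite mulr0z.
- move=> v w [d Gd] [e Ge]; exists (d - e).
  by rewrite mulrzBr; apply: GB Gd Ge.
have [d dP] : exists d, forall c, G (b *~ n%:Z, c) -> c = d *~ n%:Z.
  have [c Gc] : exists c, G (b *~ n%:Z, c) by apply/nP.
  have [n0|n_gt0] := posnP n.
    by exists 0 => e; rewrite n0 mulr0z mulr0z => /Gfun.
  have [d dE] := divE c n n_gt0; exists d => e Ge.
  rewrite -pmulrn dE; apply/eqP; rewrite -subr_eq0; apply/eqP/Gfun.
  by have := GB _ _ Ge Gc; rewrite pairB subrr.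
exists d => z e Ge.
have /dvdzP[q zE] : (n%:Z %| z)%Z by apply/nP; exists e.
have [c Gc] : exists c, G (b *~ n%:Z, c) by apply/nP.
(* Since [z = q * n], subtracting [q] times [(b *~ n, c)] from [(b *~ z, e)] leaves first coordinate
   0. *)
suff /Gfun/eqP : G (0, e - c *~ q).
  by rewrite subr_eq0 (dP _ Gc) -mulrzA mulrC -zE => /eqP.
have GN p : G p -> G (- p) by move=> Gp; rewrite -sub0r; apply: GB.
have GMn p m : G p -> G (p *+ m).
  move=> Gp; elim: m => [|m IHm] //.
  by rewrite mulrSr -[p in _ + p]opprK; apply/GB/GN.
have GM p w : G p -> G (p *~ w).
  move=> Gp; case: (intP w) => [|m|m] //; first exact: (GMn _ m.+1).
  by rewrite mulrNz; apply/GN/(GMn _ m.+1).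
have := GB _ _ Ge (GM _ q Gc); rewrite pair_mulrz pairB.
by rewrite -mulrzA mulrC -zE subrr.
Qed.

Lemma divisible_extension G : partial_hom G -> G 0 -> divisible E ->
  exists h : {additive B -> E}, forall p, G p -> h p.1 = p.2.
Proof.
move=> GP G0 divE.
(* The empty chain has empty union, so containing [G] is demanded of nonempty sets only. *)
have [F FF Ftot|H [[HP GH] Hmax]] := @Zorn_bigcup (B * E)%type
    (fun X => partial_hom X /\ (X !=set0 -> G `<=` X))%classic.
  split; first split=> [p q [X FX Xp] [Y FY Yq]|e [X FX]].
  - have [XY|YX] := Ftot _ _ FX FY.
      by exists Y => //; apply: (FF _ FY).1.1 Yq; apply: XY.
    by exists X => //; apply: (FF _ FX).1.1 Xp _; apply: YX.
  - exact: (FF _ FX).1.2.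
  - move=> [p [X FX Xp]] q Gq; exists X => //.
    by apply: (FF _ FX).2 Gq; exists p.
(* An empty [H] would not be maximal, because [G] is strictly larger. *)
have {}GH : (G `<=` H)%classic.
  have [//|/set0P/negP/negbNE/eqP H0] := pselect (H !=set0)%classic.
  case: (Hmax G); first by rewrite H0; split=> // /(_ _ G0).
  by split=> // _ p.
have H0 := GH _ G0.
have [HB Hfun] := HP.
have total b : exists e, H (b, e).
  have [d dP] := partial_hom_step b HP H0 divE.
  have [//|nHb] := pselect (exists e, H (b, e)).
  (* If [b] lay outside the domain, adjoining [(b, d)] would properly enlarge [H]. *)
  case: (Hmax (adjoin H (b, d))).
    split; first by move=> p Hp; exists 0; rewrite ?mulr0z ?subr0.
    move=> sub; apply: nHb; exists d; apply: sub; exists 1 => //.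
    by rewrite mulr1z subrr.
  split; first exact: partial_hom_adjoin.
  by move=> _ p /GH Hp; exists 0; rewrite ?mulr0z ?subr0.
have [h hP] := choice total.
have hE b e : H (b, e) -> h b = e.
  move=> He; apply/eqP; rewrite -subr_eq0; apply/eqP/Hfun.
  by have := HB _ _ (hP b) He; rewrite pairB subrr.
have hB : GRing.zmod_morphism h.
  by move=> b c; apply: hE; apply: HB (hP b) (hP c).
pose hM := GRing.isZmodMorphism.Build B E h hB.
pose hA : {additive B -> E} := HB.pack h hM.
by exists hA => -[b e] /GH /hE.
Qed.

End Extension.

(** * Characters with values in Q/Z *)

(* rat_mod1 is the group Q/Z. *)
Definition rat_mod1_pred : {pred rat} := fun q => q \is a Num.int.

Fact rat_mod1_closed : zmod_closed rat_mod1_pred.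
Proof. by split=> [|p q]; [apply: rpred0 | apply: rpredB]. Qed.

HB.instance Definition _ :=
  GRing.isZmodClosed.Build rat rat_mod1_pred rat_mod1_closed.

Definition rat_mod1 : zmodType := {quot rat_mod1_pred}.

Definition rat_mod1_proj (q : rat) : rat_mod1 := \pi_({quot rat_mod1_pred}) q.

Fact rat_mod1_proj_additive : GRing.zmod_morphism rat_mod1_proj.
Proof. by move=> p q; rewrite /rat_mod1_proj raddfB. Qed.

HB.instance Definition _ := GRing.isZmodMorphism.Build rat rat_mod1
  rat_mod1_proj rat_mod1_proj_additive.

Lemma rat_mod1_proj_eq0 q : (rat_mod1_proj q == 0) = (q \is a Num.int).
Proof.
by rewrite -(raddf0 rat_mod1_proj) -[RHS]/(q \in rat_mod1_pred)
  -[q in RHS]subr0 idealrBE.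
Qed.

Lemma rat_mod1_divisible : divisible rat_mod1.
Proof.
move=> e n n_gt0.
have <- : rat_mod1_proj (repr (e : {quot rat_mod1_pred})) = e by exact: reprK.
set q := repr _; exists (rat_mod1_proj (q / n%:R)).
by rewrite -raddfMn -(mulr_natr (q / _)) divfK // pnatr_eq0 -lt0n.
Qed.

Lemma exists_character (N : zmodType) (u : N) : u != 0 ->
  exists phi : {additive N -> rat_mod1}, phi u != 0.
Proof.
move=> u0; have [||n nP] := @int_subgroup_dvdP (fun z => u *~ z = 0).
- by rewrite mulr0z.
- by move=> a b ua ub; rewrite mulrzBr ua ub subr0.
(* [m] is the order of [u] if finite and 2 otherwise; order 1 is excluded by [u != 0]. The character
   will send [u] to the class of 1/m. *)
have [m m_gt1 mP] : exists2 m : nat, (1 < m)%N &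
    forall z : int, u *~ z = 0 -> (m%:Z %| z)%Z.
  case: n nP => [|[|n]] nP; last by exists n.+2 => // z /nP.
    by exists 2%N => // z /nP; rewrite dvd0z => /eqP->.
  by case/eqP: u0; have := (nP 1).2; apply.
have m0 : m%:R != 0 :> rat by rewrite pnatr_eq0; lia.
pose d := rat_mod1_proj m%:R^-1.
have [phi phiP] : exists h : {additive N -> rat_mod1},
    forall p, adjoin [set 0] (u, d) p -> h p.1 = p.2.
  apply: divisible_extension rat_mod1_divisible.
    apply: (partial_hom_adjoin (@partial_hom0 _ _)) => z e [/mP/dvdzP[q ->] ->].
    apply/esym/eqP; rewrite /d /= -raddfMz rat_mod1_proj_eq0 -mulrzr intrM mulrCA.
    by rewrite mulVf // mulr1 intr_int.
  by exists 0; rewrite mulr0z subr0.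
exists phi; rewrite (phiP (u, d)); last by exists 1; rewrite mulr1z subrr.
rewrite rat_mod1_proj_eq0; apply/negP => /intrP[z zE].
have : (m%:Z * z)%:~R = 1 :> rat by rewrite intrM -zE divff.
move/(@intr_inj rat _ 1) => mz.
have : (m%:Z %| 1)%Z by apply/dvdzP; exists z; rewrite mulrC mz.
by rewrite dvdz1 => /eqP m1; rewrite -[m]/(absz m) m1 in m_gt1.
Qed.

(** * Coinduced modules and enough injectives *)

Section Coinduced.
Context (R : comPzRingType) (E : zmodType).

Definition additive_fun : {pred R -> E} := fun F => `[< GRing.zmod_morphism F >].

Fact additive_fun_closed : zmod_closed additive_fun.
Proof.
split=> [|F G /asboolP FB /asboolP GB]; apply/asboolP => a b.
  by rewrite [RHS]subr0.
by rewrite /= [LHS]/(F (a - b) - G (a - b)) FB GB opprB opprD opprK addrACA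
  [_ - G a]addrC.
Qed.

HB.instance Definition _ :=
  GRing.isZmodClosed.Build (R -> E) additive_fun additive_fun_closed.

(** This is Hom_Z(R, E), on which [a] will act by precomposition with multiplication by [a]. *)
Record coinduced : Type :=
  Coinduced { coinduced_val :> R -> E; _ : coinduced_val \in additive_fun }.

HB.instance Definition _ := [isSub for coinduced_val].
HB.instance Definition _ := [Choice of coinduced by <:].
HB.instance Definition _ := [SubChoice_isSubZmodule of coinduced by <:].

Implicit Types (F G : coinduced) (a b : R).

Lemma coinducedP F : GRing.zmod_morphism F.
Proof. by case: F => F /= /asboolP. Qed.

HB.instance Definition _ F :=
  GRing.isZmodMorphism.Build R E (coinduced_val F) (coinducedP F).

Fact coinduced_scale_subproof a F : (fun r => F (r * a)) \in additive_fun.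
Proof. by apply/asboolP => r t; rewrite mulrBl raddfB. Qed.

Definition coinduced_scale a F : coinduced :=
  Coinduced (coinduced_scale_subproof a F).

Lemma coinduced_eq F G : F =1 G -> F = G.
Proof. by move=> FG; apply/val_inj/funext. Qed.

Fact coinduced_scaleA a b F :
  coinduced_scale a (coinduced_scale b F) = coinduced_scale (a * b) F.
Proof. by apply: coinduced_eq => r /=; rewrite mulrA. Qed.

Fact coinduced_scale1 : left_id 1 coinduced_scale.
Proof. by move=> F; apply: coinduced_eq => r /=; rewrite mulr1. Qed.

Fact coinduced_scaleDr : right_distributive coinduced_scale +%R.
Proof. by move=> a F G; apply: coinduced_eq. Qed.

Fact coinduced_scaleDl F : {morph coinduced_scale^~ F : a b / a + b}.
Proof.
move=> a b; apply: coinduced_eq => r.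
by rewrite -[RHS]/(F (r * a) + F (r * b)) /= mulrDr raddfD.
Qed.

HB.instance Definition _ := GRing.Zmodule_isLmodule.Build R coinduced
  coinduced_scaleA coinduced_scale1 coinduced_scaleDr coinduced_scaleDl.

Section Adjunction.
Context (B : lmodType R) (h : {additive B -> E}).

Fact coinduced_homP (b : B) : (fun r => h (r *: b)) \in additive_fun.
Proof. by apply/asboolP => r t; rewrite scalerBl raddfB. Qed.

(** The adjoint of [h] under Hom_Z(B, E) = Hom_R(B, Hom_Z(R, E)). *)
Definition coinduced_hom (b : B) : coinduced := Coinduced (coinduced_homP b).

Fact coinduced_hom_linear : linear coinduced_hom.
Proof.
move=> a b c; apply: coinduced_eq => r.
rewrite -[RHS]/(h ((r * a) *: b) + h (r *: c)) -raddfD.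
by rewrite -scalerA -scalerDr.
Qed.

HB.instance Definition _ := GRing.isLinear.Build R B coinduced *:%R
  coinduced_hom coinduced_hom_linear.

End Adjunction.

(** By adjunction it suffices to extend to [B] the additive map sending [f a] to [g a 1];
    injectivity of [f] makes it well defined. *)
Lemma coinduced_injective : divisible E -> injective_module coinduced.
Proof.
move=> divE A B f g f_inj.
pose G : set (B * E) := fun p => exists2 a, f a = p.1 & g a 1 = p.2.
have [h hP] : exists h : {additive B -> E}, forall p, G p -> h p.1 = p.2.
  apply: divisible_extension divE; last first.
    by exists 0; rewrite raddf0.
  split=> [p q [a fa ga] [b fb gb]|e [a fa ga]].
    by exists (a - b); rewrite /= raddfB /= ?fa ?fb // -ga -gb.
  have a0 : a = 0 by apply: f_inj; rewrite fa raddf0.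
  by rewrite -[e]ga a0 raddf0.
exists (coinduced_hom h) => a; apply: coinduced_eq => r /=.
rewrite -linearZ (hP (f (r *: a), g (r *: a) 1)); last by exists (r *: a).
by rewrite /= linearZ /= mul1r.
Qed.

End Coinduced.

Lemma divisible_fun (J : Type) (E : zmodType) :
  divisible E -> divisible (J -> E).
Proof.
move=> divE F n n_gt0.
have [d dP] := choice (fun j => divE (F j) n n_gt0).
exists d; apply/funext => j; rewrite -dP.
by elim: n {n_gt0 dP} => [|n IHn] //; rewrite !mulrS -IHn.
Qed.

(** Characters separate points, so joint evaluation at all of them is injective; evaluating its
    adjoint at 1 recovers it. *)
Lemma enough_injectives (R : comPzRingType) (N : lmodType R) :
  exists I : lmodType R, injective_module I /\
  exists f : {linear N -> I}, injective f.
Proof.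
pose J := {additive N -> rat_mod1}.
pose ev (u : N) : J -> rat_mod1 := fun phi => phi u.
have evB : GRing.zmod_morphism ev.
  by move=> u v; apply/funext => phi; rewrite /ev raddfB.
pose evM := GRing.isZmodMorphism.Build _ _ ev evB.
pose evA : {additive N -> J -> rat_mod1} := HB.pack ev evM.
exists (coinduced R (J -> rat_mod1)); split.
  exact/coinduced_injective/divisible_fun/rat_mod1_divisible.
exists (coinduced_hom evA); apply: raddf_inj => u /(congr1 val) /= u0.
apply: contrapT => /eqP/exists_character[phi /eqP]; apply.
by have /(congr1 (@^~ phi)) := congr1 (@^~ 1) u0; rewrite /= /ev scale1r.
Qed.

(** * Maps out of quotient modules *)

Section QuotientLift.
Context (R : comPzRingType) (U V : lmodType R) (A : submodClosed U).
Context (f : {linear U -> V}).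

Definition quot_lift (_ : forall u, u \in A -> f u = 0) (q : quot_mod A) : V :=
  f (repr (q : {quot (zpred A)})).

Context (fA : forall u, u \in A -> f u = 0).

Lemma quot_liftE u : quot_lift fA (quot_proj A u) = f u.
Proof.
apply/eqP; rewrite /quot_lift -subr_eq0 -raddfB; apply/eqP/fA.
by rewrite -[_ \in _]/(_ \in zpred A) idealrBE /quot_proj reprK.
Qed.

Fact quot_lift_linear : linear (quot_lift fA).
Proof.
move=> a p q; have [u <-] := quot_proj_surj p; have [v <-] := quot_proj_surj q.
by rewrite -linearP !quot_liftE linearP.
Qed.

HB.instance Definition _ := GRing.isLinear.Build R (quot_mod A) V *:%R
  (quot_lift fA) quot_lift_linear.

End QuotientLift.

(** * Torsion in Hom(M, I) *)

Section Torsion.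
Context (R : comPzRingType).
Implicit Types (s : seq R) (n : nat).

Lemma mem_genideal s j : (j < size s)%N -> s`_j \in genideal s.
Proof.
move=> js; apply/asboolP; exists (fun i => (i == Ordinal js)%:R).
rewrite (bigD1 (Ordinal js)) //= eqxx mul1r big1 ?addr0 // => i /negPf->.
by rewrite mul0r.
Qed.

Lemma ideal_exp_pow (I : submodClosed R^o) (z : R) n :
  z \in I -> z ^+ n \in ideal_exp I n.
Proof.
move=> zI; elim: n => [|n IHn] //; apply/asboolP.
exists [:: (z, z ^+ n)]; first by rewrite /= zI IHn.
by rewrite big_seq1 /= exprS.
Qed.

(** Expanding the factor in the ideal over the generators moves one generator at a time onto [g];
    this is the inductive step for ideal powers. *)
Lemma ideal_mul_annihilates (X : lmodType R) s (K : submodClosed R^o) (g : X) :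
    (forall (j : 'I_(size s)) (c : R), c \in K -> c *: (s`_j *: g) = 0) ->
  forall a : R, a \in ideal_mul (genideal s) K -> a *: g = 0.
Proof.
move=> gK a /asboolP[t tP ->].
rewrite scaler_suml big_seq big1 // => -[b c] /(allP tP) /= /andP[bI cK].
case/asboolP: bI => d ->; rewrite -[_ *: c]/(_ * c : R) mulrC -scalerA.
rewrite scaler_suml scaler_sumr big1 // => j _.
by rewrite -scalerA [LHS]scalerA mulrC -scalerA gK // scaler0.
Qed.

(* The module elements s_j g are annihilated by the same powers of the
   generators as g, with the exponent of s_j lowered by one; hence induction
   on the total exponent. *)
Lemma ideal_exp_annihilates (X : lmodType R) s (e : 'I_(size s) -> nat) N
    (g : X) :
    (\sum_j e j <= N)%N -> (forall j : 'I_(size s), s`_j ^+ e j *: g = 0) ->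
  forall a : R, a \in ideal_exp (genideal s) N.+1 -> a *: g = 0.
Proof.
elim: N e g => [|N IHN] e g eN eg; apply: ideal_mul_annihilates => j c cI.
  have := eg j; have -> : e j = 0%N.
    by apply/eqP; move: eN; rewrite leqn0 sum_nat_eq0 => /forallP/(_ j).
  by rewrite expr0 scale1r => ->; rewrite !scaler0.
have [ej0|ej_gt0] := posnP (e j).
  by have := eg j; rewrite ej0 expr0 scale1r => ->; rewrite !scaler0.
apply: (IHN (fun i => e i - (i == j))%N) => // [|i].
  rewrite (bigD1 j) //= eqxx subn1 (eq_bigr e) => [|i /negPf->]; last first.
    by rewrite subn0.
  by move: eN; rewrite (bigD1 j) //=; set S := \sum_(i | _) _; lia.
have [->|ij] := eqVneq i j; last first.
  by rewrite subn0 scalerA mulrC -scalerA eg scaler0.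
by rewrite scalerA -exprSr -[true : nat]/1%N subn1 prednK ?eg.
Qed.

(** By linearity (s_j^n f)(u) = f(s_j^n u), and the elements s_j^n u generate s^(n) M. *)
Lemma pow_sub_kernelP (M I : lmodType R) s n (f : hom_mod M I) :
  (forall j : 'I_(size s), s`_j ^+ n *: f = 0) <->
  (forall u, u \in pow_sub M s n -> f u = 0).
Proof.
split=> [sf u /asboolP[t tP ->]|fn j].
  rewrite raddf_sum big_seq big1 // => -[a v] /(allP tP) /andP[/= aI _].
  rewrite linearZ /=; case/asboolP: aI; rewrite size_map => c ->.
  rewrite scaler_suml big1 // => j _; rewrite (nth_map 0) // -scalerA.
  by rewrite -[s`_j ^+ n *: f v]/((s`_j ^+ n *: f) v) sf scaler0.
apply: hom_modP => u; rewrite -[LHS]/(s`_j ^+ n *: f u) -linearZ fn //.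
apply/asboolP; exists [:: (s`_j ^+ n, u)]; last by rewrite big_seq1.
rewrite /= andbT; apply/andP; split=> //.
rewrite -(nth_map 0 0 (fun z => z ^+ n)) //; apply: mem_genideal.
by rewrite size_map.
Qed.

Lemma torsion_homP (M I : lmodType R) s (f : hom_mod M I) :
  f \in torsion _ (genideal s) <->
  exists2 n, (0 < n)%N & forall u, u \in pow_sub M s n -> f u = 0.
Proof.
split=> [/asboolP[n n_gt0 fn]|[n n_gt0 /pow_sub_kernelP fn]].
  exists n => //; apply/pow_sub_kernelP => j.
  exact/fn/ideal_exp_pow/mem_genideal.
(* For r generators the total exponent is r n, so the ideal power r n + 1 kills [f]. *)
apply/asboolP; exists (\sum_(j < size s) n).+1 => //.
exact: (ideal_exp_annihilates (e := fun=> n)).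
Qed.

End Torsion.

(** * Vanishing of Cech cohomology and the equivalence for one index *)

Lemma cech_H1_eq0P (R : comPzRingType) (y : R) (X : lmodType R) :
  (forall h : cech_H1 y X, h = 0) <->
  (forall (f : X) n, exists (g : X) l, y ^+ l *: f = y ^+ (l + n) *: g).
Proof.
split=> [H0 f n|H h].
  have /eqP := H0 (quot_proj _ (loc_frac y f n)).
  rewrite quot_proj_eq0 => /asboolP[g /loc_fracP[l lE]].
  by exists g, l; rewrite lE addn0.
have [q <-] := quot_proj_surj h; have [f [n <-]] := loc_fracX q.
apply/eqP; rewrite quot_proj_eq0; apply/asboolP.
have [g [l lE]] := H f n; exists g; apply/loc_fracP; exists l.
by rewrite addn0 lE.
Qed.

Section ProregularStep.
Context (R : comPzRingType) (M : lmodType R) (s : seq R) (y : R).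

(** For [n <= m], [proreg_map_eq0] identifies this with the vanishing of the transition map. *)
Definition colon_bound m n := forall u : M,
  u \in pow_colon M s y m -> u \in colon (pow_sub M s n) (y ^+ (m - n)).

Lemma colon_bound_extension (I : lmodType R) m n (f : hom_mod M I) :
    injective_module I -> colon_bound m n ->
    (forall u, u \in pow_sub M s n -> f u = 0) ->
  exists2 g : hom_mod M I, (forall u, u \in pow_sub M s m -> g u = 0) &
    y ^+ m *: g = y ^+ (m - n) *: f.
Proof.
move=> injI mn fn.
pose ym := *:%R (y ^+ m) : {linear M -> M}.
pose N := pow_sub M s m; pose C := pow_colon M s y m.
have ymC u : u \in C -> ym u \in N by [].
pose yf : {linear M -> I} := y ^+ (m - n) *: f : hom_mod M I.
have yfC u : u \in C -> yf u = 0.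
  by move=> /mn/fn; rewrite linearZ.
(* [C] is the preimage of [N] under [ym], so the induced map from M/C to M/N is injective. *)
have [|h hE] := injI _ _ (quot_map ymC) (quot_lift yfC).
  apply: raddf_inj => q; have [u <-] := quot_proj_surj q.
  rewrite /= quot_mapE => /eqP; rewrite quot_proj_eq0 => uC.
  by apply/eqP; rewrite quot_proj_eq0.
exists (h \o quot_proj N : {linear M -> I}).
  move=> u; rewrite -quot_proj_eq0 => /eqP u0.
  by rewrite /= u0 raddf0.
apply: hom_modP => u; rewrite -[RHS]/(yf u) -(quot_liftE yfC) -hE /= quot_mapE.
by rewrite !linearZ.
Qed.

Lemma colon_boundP :
  (forall n, (0 < n)%N -> exists2 m, (n <= m)%N & colon_bound m n) <->
  (forall I : lmodType R, injective_module I ->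
   forall h : cech_H1 y (Gamma (genideal s) (hom_mod M I)), h = 0).
Proof.
split=> [bound I injI|H n n_gt0].
  apply/cech_H1_eq0P => f n.
  have [n0 n0_gt0 fn0] := (torsion_homP s (submod_val f)).1 (submod_valP f).
  (* [r] dominates both the denominator exponent [n] and the level [n0] at which [f] vanishes. *)
  pose r := maxn n n0.
  have [|m le_rm mr] := bound r; first by rewrite leq_max n0_gt0 orbT.
  have [|g gm gE] := colon_bound_extension (f := submod_val f) injI mr.
    by move=> u /(pow_sub_le (leq_maxr n n0)) /fn0.
  have g_tors : g \in torsion _ (genideal s).
    apply/torsion_homP; exists m => //; apply: leq_trans le_rm.
    by rewrite leq_max n0_gt0 orbT.
  (* From y^m g = y^(m-r) f, the fraction f / y^n is the image of y^(r-n) g. *)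
  exists (y ^+ (r - n) *: Submod g_tors), (m - r)%N; apply: val_inj => /=.
  rewrite -gE scalerA -exprD; congr (_ ^+ _ *: _).
  by have := leq_maxl n n0; lia.
have [I [injI [j j_inj]]] := enough_injectives (quot_mod (pow_sub M s n)).
pose f : hom_mod M I := (j \o quot_proj (pow_sub M s n) : {linear M -> I}).
have fE u : (f u == 0) = (u \in pow_sub M s n).
  by rewrite -quot_proj_eq0 /= raddf_eq0.
have f_tors : f \in torsion _ (genideal s).
  by apply/torsion_homP; exists n => // u; rewrite -fE => /eqP.
have [g [l /(congr1 val) /= lE]] :=
  (cech_H1_eq0P _ _).1 (H I injI) (Submod f_tors) n.
have [n1 n1_gt0 gn1] :=
  (torsion_homP s (submod_val g)).1 (submod_valP g).
(* [m - n] must reach [l] for [lE] to apply, and [m] must reach [n1] for [g] to vanish on s^(m)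
   M. *)
pose m := (l + n + n1)%N; exists m => [|u]; first by lia.
rewrite !colonE -fE => um.
have fg : y ^+ (m - n) *: f = y ^+ m *: submod_val g.
  rewrite (_ : m - n = n1 + l)%N; last by lia.
  rewrite (_ : m = n1 + (l + n))%N; last by lia.
  by rewrite !exprD -scalerA lE -exprD !scalerA -!exprD.
rewrite (_ : f _ = (y ^+ (m - n) *: f : hom_mod M I) u); last first.
  by rewrite /= !linearZ.
rewrite fg -[_ u]/(y ^+ m *: submod_val g u) -linearZ gn1 //.
by apply: pow_sub_le um; lia.
Qed.

End ProregularStep.

Theorem theorem0p1 (R : comPzRingType) (k : nat) (x : k.-tuple R)
    (M : lmodType R) :
  proregular M x
  <-> (forall (i : 'I_k) (I : lmodType R), injective_module I ->
       forall h : cech_H1 (tnth x i) (Gamma (genideal (take i x)) (hom_mod M I)),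
         h = 0%R).
Proof.
split=> [Mx i|H i n n_gt0].
  apply/colon_boundP => n /(Mx i)[m [le_nm /proreg_map_eq0 mn]].
  by exists m.
have [m le_nm mn] := (colon_boundP M (take i x) (tnth x i)).2 (H i) n n_gt0.
by exists m, le_nm; apply/proreg_map_eq0.
Qed.
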